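(* Let $(S,\mathcal{A},\mu)$ be a complete, $\sigma$-finite measure space, $E$ a Köthe function space over $(S,\mathcal{A},\mu)$ and $X$ a Banach space. If $E$ is LUR and $X$ is sluacs, then $E(X)$ is also sluacs.
   Context: All Banach spaces are real. For a Banach space $X$, $X^*$ denotes its dual, $B_X$ its closed unit ball and $S_X$ its unit sphere. A Banach space $X$ is called: - LUR (locally uniformly rotund) if for every $x\in S_X$ and every sequence $(x_n)$ in $S_X$, $\|x_n+x\|\to2$ implies $\|x_n-x\|\to0$; - sluacs (strongly locally uniformly alternatively convex or smooth) if for every $x\in S_X$ and all sequences $(x_n)$ in $S_X$ and $(x_n^* )$ in $S_{X^*}$: $\|x_n+x\|\to2$ and $x_n^*(x_n)\to1$ imply $x_n^*(x)\to1$. A Köthe function space over a complete, $\sigma$-finite measure space $(S,\mathcal{A},\mu)$ is a Banach space $(E,\|\cdot\|_E)$ of real-valued measurable functions on $S$ modulo equality $\mu$-a.e. such that: (i) $\chi_A\in E$ for every $A\in\mathcal{A}$ with $\mu(A)<\infty$; (ii) every $f\in E$ is $\mu$-integrable over every $A\in\mathcal{A}$ with $\mu(A)<\infty$; (iii) if $g$ is measurable and $f\in E$ with $|g(t)|\le|f(t)|$ $\mu$-a.e., then $g\in E$ and $\|g\|_E\le\|f\|_E$. For a Köthe function space $E$ and a Banach space $X$, the Köthe-Bochner space $E(X)$ is the Banach space of all Bochner-measurable functions $f:S\to X$ (modulo equality a.e.) with $\|f(\cdot)\|\in E$, normed by $\|f\|_{E(X)}=\|\,\|f(\cdot)\|\,\|_E$;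 Bochner-measurable means being the $\mu$-a.e. norm limit of a sequence of simple functions. *)

(* Defs.v *)
From HB Require Import structures.
From mathcomp Require Import all_boot all_order all_algebra.
From mathcomp Require Import all_classical all_reals all_analysis.
From mathcomp Require Import measurable_realfun.

Set Implicit Arguments.
Unset Strict Implicit.
Unset Printing Implicit Defensive.

Import Order.TTheory GRing.Theory Num.Theory.
Import numFieldNormedType.Exports.

Local Open Scope classical_set_scope.
Local Open Scope ring_scope.

Section Rotundity.
Context {R : realType} (X : normedModType R).

Definition LUR : Prop :=
  forall (x : X) (u : nat -> X),
    `|x| = 1 -> (forall n, `|u n| = 1) ->
    `|u n + x| @[n --> \oo] --> (2 : R) ->
    `|u n - x| @[n --> \oo] --> (0 : R).

(* Meaningful for continuous functionals: otherwise the
   supremum is taken over an unbounded set and is 0 by convention. *)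
Definition dual_norm (phi : X -> R) : R :=
  sup [set `|phi x| | x in [set x : X | `|x| <= 1]].

Definition dual_sphere (phi : {scalar X}) : Prop :=
  continuous (phi : X -> R) /\ dual_norm phi = 1.

Definition sluacs : Prop :=
  forall (x : X) (u : nat -> X) (phi : nat -> {scalar X}),
    `|x| = 1 -> (forall n, `|u n| = 1) -> (forall n, dual_sphere (phi n)) ->
    `|u n + x| @[n --> \oo] --> (2 : R) ->
    (phi n (u n) : R) @[n --> \oo] --> (1 : R) ->
    (phi n x : R) @[n --> \oo] --> (1 : R).

End Rotundity.

(* A linear space of functions T -> X carrying a seminorm whose kernel is the
   set of functions vanishing almost everywhere; [fnorm] is only meaningful
   on [fmem]. *)
Record function_space d (T : measurableType d) (R : realType)
    (mu : {measure set T -> \bar R}) (X : lmodType R) := FunctionSpace {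
  fmem : set (T -> X);
  fnorm : (T -> X) -> R;
  fmem0 : fmem (fun=> 0);
  fmemD : forall f g, fmem f -> fmem g -> fmem (fun t => f t + g t);
  fmemZ : forall (a : R) f, fmem f -> fmem (fun t => a *: f t);
  fnormD : forall f g, fmem f -> fmem g ->
    fnorm (fun t => f t + g t) <= fnorm f + fnorm g;
  fnormZ : forall (a : R) f, fmem f ->
    fnorm (fun t => a *: f t) = `|a| * fnorm f;
  fnorm_eq0 : forall f, fmem f ->
    fnorm f = 0 <-> {ae mu, forall t, f t = 0}
}.

Section Carrier.
Context d (T : measurableType d) (R : realType).
Context (mu : {measure set T -> \bar R}) (X : lmodType R).
Context (F : function_space mu X).

Definition fpred : {pred T -> X} := mem (fmem F).

Lemma fpred_submod : submod_closed fpred.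
Proof.
split; first by rewrite inE; exact: fmem0.
move=> a f g; rewrite !inE => Ff Fg.
exact: (fmemD (fmemZ a Ff) Fg).
Qed.

HB.instance Definition _ := GRing.isSubmodClosed.Build _ _ fpred fpred_submod.

Record fsub := FSub { fval :> T -> X; fvalP : fval \in fpred }.

HB.instance Definition _ := [isSub of fsub for fval].
HB.instance Definition _ := [Choice of fsub by <:].
HB.instance Definition _ := [SubChoice_isSubLmodule of fsub by <:].

Definition aezero : {pred fsub} :=
  mem [set f : fsub | {ae mu, forall t, f t = 0}].

Lemma aezero_submod : submod_closed aezero.
Proof.
split; first by rewrite inE /=; apply: aeW.
move=> a f g; rewrite !inE /= => f0 g0.
by apply: filterS2 f0 g0 => t ft gt; rewrite !fctE ft gt scaler0 addr0.
Qed.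

HB.instance Definition _ :=
  GRing.isSubmodClosed.Build _ _ aezero aezero_submod.

End Carrier.

Arguments fpred {d T R mu X} F.
Arguments aezero {d T R mu X} F.

Section Classes.
Context d (T : measurableType d) (R : realType).
Context (mu : {measure set T -> \bar R}) (X : lmodType R).
Context (F : function_space mu X).

Local Open Scope quotient_scope.

(* F modulo equality almost everywhere *)
Definition fclass := Quotient.quot (aezero F).

HB.instance Definition _ := Choice.on fclass.
HB.instance Definition _ := GRing.Zmodule.on fclass.
HB.instance Definition _ := EqQuotient.on fclass.

Lemma fclass_eqP (f g : fsub F) :
  \pi_fclass f = \pi_fclass g <-> {ae mu, forall t, f t = g t}.
Proof.
have -> : {ae mu, forall t, f t = g t} <-> f - g \in aezero F.
  rewrite inE /=; split; apply: filterS => t; first by move/eqP; rewrite -subr_eq0 => /eqP.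
  by move/eqP; rewrite subr_eq0 => /eqP.
by rewrite Quotient.idealrBE; split=> [/eqP|/eqP].
Qed.

Let pi_repr (f : fsub F) :
  {ae mu, forall t, (repr (\pi_fclass f) : fsub F) t = f t}.
Proof. by apply/fclass_eqP; rewrite reprK. Qed.

Definition fclass_scale (a : R) (c : fclass) : fclass :=
  \pi_fclass (a *: (repr c : fsub F)).

Let scale_pi a (f : fsub F) :
  fclass_scale a (\pi_fclass f) = \pi_fclass (a *: f).
Proof.
apply/fclass_eqP; apply: filterS (pi_repr f) => t ft.
exact: (congr1 ( *:%R a) ft).
Qed.

Let piD (f g : fsub F) : \pi_fclass (f + g) = \pi_fclass f + \pi_fclass g.
Proof. by rewrite (Quotient.pi_add (aezero F)). Qed.

Let fclass_scaleA a b c :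
  fclass_scale a (fclass_scale b c) = fclass_scale (a * b) c.
Proof. by elim/quotW: c => f; rewrite (scale_pi b f) !scale_pi scalerA. Qed.

Let fclass_scale1 : left_id 1 fclass_scale.
Proof. by elim/quotW=> f; rewrite scale_pi scale1r. Qed.

Let fclass_scaleDr : right_distributive fclass_scale +%R.
Proof.
move=> a; elim/quotW=> f; elim/quotW=> g.
by rewrite -piD !scale_pi -piD scalerDr.
Qed.

Let fclass_scaleDl c : {morph fclass_scale^~ c : a b / a + b}.
Proof. by move=> a b; elim/quotW: c => f; rewrite !scale_pi -piD scalerDl. Qed.

HB.instance Definition _ := GRing.Zmodule_isLmodule.Build R fclass
  fclass_scaleA fclass_scale1 fclass_scaleDr fclass_scaleDl.

Definition fclass_norm (c : fclass) : R := fnorm F (repr c : fsub F).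

Let fsubP (f : fsub F) : fmem F f.
Proof. by have := fvalP f; rewrite inE. Qed.

Let fnorm_ae_le (f g : fsub F) :
  {ae mu, forall t, f t = g t} -> fnorm F f <= fnorm F g.
Proof.
move=> fg; have -> : f = (g + (f - g)) by rewrite addrC subrK.
apply: le_trans (fnormD (fsubP g) (fsubP (f - g))) _.
rewrite (_ : fnorm F (f - g) = 0) ?addr0//.
apply/(fnorm_eq0 (fsubP _)).
by apply: filterS fg => t /eqP; rewrite -subr_eq0 => /eqP.
Qed.

Lemma fclass_normE (f : fsub F) : fclass_norm (\pi_fclass f) = fnorm F f.
Proof.
apply/eqP; rewrite eq_le; apply/andP; split; apply: fnorm_ae_le => //.
by apply: filterS (pi_repr f) => t ->.
Qed.

Let fclass_normD c e :
  fclass_norm (c + e) <= fclass_norm c + fclass_norm e.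
Proof.
elim/quotW: c => f; elim/quotW: e => g; rewrite -piD !fclass_normE.
exact: (fnormD (fsubP _) (fsubP _)).
Qed.

Let fclass_normZ a c : fclass_norm (a *: c) = `|a| * fclass_norm c.
Proof.
elim/quotW: c => f; rewrite [a *: _]scale_pi !fclass_normE.
exact: (fnormZ a (fsubP _)).
Qed.

Let fclass_norm0_eq0 c : fclass_norm c = 0 -> c = 0.
Proof.
elim/quotW: c => f; rewrite fclass_normE => /(fnorm_eq0 (fsubP _)) h.
have <- : \pi_fclass (0 : fsub F) = 0.
  by apply: (addrI (\pi_fclass (0 : fsub F))); rewrite -piD !addr0.
exact/fclass_eqP.
Qed.

HB.instance Definition _ := Lmodule_isNormed.Build R fclass
  fclass_normD fclass_normZ fclass_norm0_eq0.

Lemma norm_fclassE (f : fsub F) : `|\pi_fclass f : fclass| = fnorm F f.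
Proof. exact: fclass_normE. Qed.

End Classes.

(* Elements are representatives; [fclass] of the underlying function space is
   the Banach space itself, and [kothe_complete] is the [cauchy_cvg] axiom of
   [completeType] for it. *)
Record kothe_space d (T : measurableType d) (R : realType)
    (mu : {measure set T -> \bar R}) := KotheSpace {
  kothe_fun :> function_space mu R;
  kothe_measurable : forall f, fmem kothe_fun f -> measurable_fun setT f;
  kothe_complete : forall G : set_system (fclass kothe_fun),
    ProperFilter G -> cauchy G -> cvg G;
  kothe_indic : forall A, measurable A -> (mu A < +oo)%E ->
    fmem kothe_fun \1_A;
  kothe_integrable : forall f A, fmem kothe_fun f ->
    measurable A -> (mu A < +oo)%E -> mu.-integrable A (EFin \o f);
  kothe_ideal : forall f g : T -> R, fmem kothe_fun f ->
    measurable_fun setT g -> {ae mu, forall t, `|g t| <= `|f t|} ->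
    fmem kothe_fun g /\ fnorm kothe_fun g <= fnorm kothe_fun f
}.

Section BochnerMeasurable.
Context d (T : measurableType d) (R : realType).
Context (mu : {measure set T -> \bar R}).

(* The fibers may have infinite measure; over a sigma-finite measure this gives
   the same Bochner-measurable functions as finitely supported ones. *)
Definition simple_fun (X : Type) (s : T -> X) : Prop :=
  finite_set (range s) /\ forall x, measurable (s @^-1` [set x]).

Definition bochner_measurable (X : normedModType R) (f : T -> X) : Prop :=
  exists2 s : nat -> T -> X, forall n, simple_fun (s n) &
    {ae mu, forall t, s n t @[n --> \oo] --> f t}.

Lemma simple_fun_preimage (X : Type) (s : T -> X) (Y : set X) :
  simple_fun s -> measurable (s @^-1` Y).
Proof.
case=> fs ms.
rewrite (_ : s @^-1` Y = \bigcup_(x in range s `&` Y) (s @^-1` [set x])).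
  by apply: fin_bigcup_measurable => // ; exact: finite_setIl.
apply/seteqP; split=> t /=; last by move=> [x [_ Yx] ->].
by exists (s t) => //; split=> //; exists t.
Qed.

Lemma simple_fun2 (X Y Z : Type) (op : X -> Y -> Z) (s : T -> X) (u : T -> Y) :
  simple_fun s -> simple_fun u -> simple_fun (fun t => op (s t) (u t)).
Proof.
move=> ss su; split.
  apply: (@sub_finite_set _ _
      [set op x y | x in range s & y in range u]).
    move=> _ [t _ <-]; exists (s t); first by exists t.
    by exists (u t) => //; exists t.
  by apply: finite_image2; [case: ss|case: su].
move=> z.
rewrite (_ : _ @^-1` _ = \bigcup_(x in range s)
    (s @^-1` [set x] `&` u @^-1` [set y | op x y = z])).
  apply: fin_bigcup_measurable; first by case: ss.
  by move=> x _; apply: measurableI; apply: simple_fun_preimage.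
apply/seteqP; split=> t /=; last by move=> [x _ [-> ->]].
by exists (s t) => //; exists t.
Qed.

Lemma simple_fun_comp (X Y : Type) (op : X -> Y) (s : T -> X) :
  simple_fun s -> simple_fun (fun t => op (s t)).
Proof. by move=> ss; apply: (simple_fun2 (fun x _ => op x) ss ss). Qed.

Lemma simple_fun_cst (X : Type) (x : X) : simple_fun (fun=> x).
Proof.
split=> [|y]; last by rewrite preimage_cst; case: ifP.
by apply: (@sub_finite_set _ _ [set x]) => // _ [t _ <-].
Qed.

Context (X : normedModType R).
Implicit Types f g : T -> X.

Lemma bochner_measurable0 : bochner_measurable (fun=> 0 : X).
Proof.
exists (fun _ _ => 0) => [n|]; first exact: simple_fun_cst.
by apply: aeW => t; exact: cvg_cst.
Qed.

Lemma bochner_measurableD f g : bochner_measurable f ->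
  bochner_measurable g -> bochner_measurable (fun t => f t + g t).
Proof.
move=> [s ss sf] [u su ug].
exists (fun n t => s n t + u n t) => [n|]; first exact: simple_fun2.
by apply: filterS2 sf ug => t; exact: cvgD.
Qed.

Lemma bochner_measurableZ (a : R) f :
  bochner_measurable f -> bochner_measurable (fun t => a *: f t).
Proof.
move=> [s ss sf].
exists (fun n t => a *: s n t) => [n|].
  exact: (simple_fun_comp ( *:%R a)).
by apply: filterS sf => t; exact: cvgZr.
Qed.

Lemma measurable_norm_bochner f : measure_is_complete mu ->
  bochner_measurable f -> measurable_fun setT (fun t => `|f t|).
Proof.
move=> cmu [s ss sf].
set N := ~` [set t | s n t @[n --> \oo] --> f t].
have mN : measurable N by apply: cmu; exact: sf.
pose h n t : R := `|s n t| * \1_(~` N) t.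
pose k t : R := `|f t| * \1_(~` N) t.
have mh n : measurable_fun setT (h n).
  apply: measurable_funM; last exact/measurable_indic/measurableC.
  move=> _ Y _; rewrite setTI.
  exact: simple_fun_preimage (simple_fun_comp Num.norm (ss n)).
have mk : measurable_fun setT k.
  apply: (measurable_fun_cvg mh) => t _; rewrite /h /k indicE.
  have [/set_mem|] := boolP (t \in ~` N).
    rewrite /N setCK /= => sft.
    by apply: cvgMl; exact: cvg_norm.
  by rewrite mulr0 => _; under eq_fun do rewrite mulr0; exact: cvg_cst.
apply/measurable_EFinP/(ae_measurable_fun cmu _ (g := EFin \o fun t => `|f t|)
  (f := EFin \o k)); last exact/measurable_EFinP.
apply: filterS sf => t st _ /=.
by rewrite /k indicE mem_set ?mulr1// /N setCK.
Qed.

End BochnerMeasurable.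

(* Completeness of [mu] is what makes [fun t => `|f t|] measurable when [f] is
   an a.e. limit of simple functions. *)
Section KotheBochner.
Context d (T : measurableType d) (R : realType).
Context (mu : {measure set T -> \bar R}).
Context (cmu : measure_is_complete mu).
Context (E : kothe_space mu) (X : normedModType R).
Implicit Types f g : T -> X.

Definition kb_mem : set (T -> X) :=
  [set f | bochner_measurable mu f /\ fmem E (fun t => `|f t|)].

Definition kb_norm f : R := fnorm E (fun t => `|f t|).

Let kb_mem0 : kb_mem (fun=> 0).
Proof.
split; first exact: bochner_measurable0.
by under eq_fun do rewrite normr0; exact: fmem0.
Qed.

Let kb_add f g : kb_mem f -> kb_mem g ->
  fmem E (fun t => `|f t + g t|) /\ kb_norm (fun t => f t + g t)
    <= fnorm E (fun t => `|f t| + `|g t|).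
Proof.
move=> [bf Ef] [bg Eg]; apply: kothe_ideal; first exact: fmemD.
  exact/(measurable_norm_bochner cmu)/bochner_measurableD.
apply: aeW => t; rewrite normr_id [leRHS]ger0_norm ?addr_ge0//.
exact: ler_normD.
Qed.

Let kb_memD f g : kb_mem f -> kb_mem g -> kb_mem (fun t => f t + g t).
Proof.
move=> kf kg; split; last by have [] := kb_add kf kg.
by apply: bochner_measurableD; [case: kf|case: kg].
Qed.

Let normZ (a : R) f : (fun t => `|a *: f t|) = (fun t => `|a| *: `|f t|).
Proof. by apply/funext => t; rewrite normrZ. Qed.

Let kb_memZ (a : R) f : kb_mem f -> kb_mem (fun t => a *: f t).
Proof.
move=> [bf Ef]; split; first exact: bochner_measurableZ.
by rewrite normZ; exact: fmemZ.
Qed.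

Let kb_normD f g : kb_mem f -> kb_mem g ->
  kb_norm (fun t => f t + g t) <= kb_norm f + kb_norm g.
Proof.
move=> kf kg; have [_ /le_trans] := kb_add kf kg; apply.
by apply: fnormD; [case: kf|case: kg].
Qed.

Let kb_normZ (a : R) f : kb_mem f ->
  kb_norm (fun t => a *: f t) = `|a| * kb_norm f.
Proof. by move=> [_ Ef]; rewrite /kb_norm normZ fnormZ ?normr_id. Qed.

Let kb_norm_eq0 f : kb_mem f ->
  kb_norm f = 0 <-> {ae mu, forall t, f t = 0}.
Proof.
move=> [_ Ef]; rewrite /kb_norm (fnorm_eq0 Ef).
split; apply: filterS => t; first exact: normr0_eq0.
by move=> ->; rewrite normr0.
Qed.

Definition kothe_bochner : function_space mu X :=
  FunctionSpace kb_mem0 kb_memD kb_memZ kb_normD kb_normZ kb_norm_eq0.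

End KotheBochner.

(* Main.v *)
Require Import Defs.
From HB Require Import structures.
From mathcomp Require Import all_boot all_order all_algebra.
From mathcomp Require Import all_classical all_reals all_analysis.
From mathcomp Require Import measurable_realfun lra.

Set Implicit Arguments.
Unset Strict Implicit.
Unset Printing Implicit Defensive.

Import Order.TTheory GRing.Theory Num.Theory.
Import numFieldNormedType.Exports.

Local Open Scope classical_set_scope.
Local Open Scope ring_scope.

(** Let [`|f n + f|] tend to [2] and [phi n (f n)] to [1] on the unit sphere of
    the Bochner space. No description of its dual is used: by Hahn-Banach, the
    property [sluacs] is equivalent to an estimate on norms alone, namely that for
    each [e] some step [t] makes [`|f n - t *: f| <= 1 - t * (1 - e)] for large
    [n] ([sluacs_slope], and [sluacs_of_slope] for the converse, where infinitely
    many [n] suffice). This estimate is then carried from [X] to the Bochner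
    space.

    Rotundity of [E] turns the hypothesis on norms into a pointwise one: the
    functions [`|f n t|] converge to [`|f t|] and the functions [`|f n t + f t|] to
    [2 * `|f t|], both in [E] ([LUR_norms_cvg]), hence almost everywhere along a
    subsequence ([kothe_cvg0_ae_subseq]). So the estimate of [X] holds at almost
    every point [t], but with a step and a starting index that depend on [t]. By
    convexity the sets on which the step [1 / m.+1] works from index [m] on
    increase with [m], and cover almost every point. Outside them the triangle
    inequality costs at most [2 / m.+1] times the norm of [f] cut to their
    complements, and this norm tends to [0] because a locally uniformly rotund
    norm is order continuous ([LUR_order_continuous]).

    Order continuity is proved by a monotonicity argument. If it failed, some
    [f >= 0] would have infinitely many disjoint pieces of norm at least [c > 0].
    Index these by the rationals and let [B r] be the union of the pieces with
    index below [r]: the norm of [f] cut to [B r] is a nondecreasing function of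
    the real number [r], hence left-continuous at some [r], where rotundity is
    contradicted ([LUR_no_large_pieces]). *)

(** * Norming functionals *)

Section HahnBanach.
Context {R : realType} (V : normedModType R).

Definition sublinear_below_norm (p : V -> R) : Prop :=
  [/\ forall x y, p (x + y) <= p x + p y,
      forall t x, 0 < t -> p (t *: x) <= t * p x &
      forall x, p x <= `|x|].

Lemma sublinear_norm : sublinear_below_norm (fun x => `|x|).
Proof.
split=> [x y|t x t0|//]; first exact: ler_normD.
by rewrite normrZ gtr0_norm.
Qed.

Lemma sublinear0 p : sublinear_below_norm p -> p 0 = 0.
Proof.
case=> pD _ pn; apply/eqP; rewrite eq_le; have := pn 0; rewrite normr0 => -> /=.
by have := pD 0 0; rewrite addr0 -lerBlDl subrr.
Qed.

Lemma sublinear_lbound p x : sublinear_below_norm p -> - `|x| <= p x.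
Proof.
move=> sp; have [pD _ pn] := sp.
have := pD x (- x); rewrite subrr sublinear0// => h.
have := pn (- x); rewrite normrN; lra.
Qed.

Lemma sublinear_homog p t x : sublinear_below_norm p -> 0 <= t ->
  p (t *: x) = t * p x.
Proof.
move=> sp; rewrite le_eqVlt => /orP[/eqP <-|t0].
  by rewrite scale0r mul0r sublinear0.
have [_ pZ _] := sp; apply/eqP; rewrite eq_le pZ//=.
have := pZ t^-1 (t *: x); rewrite invr_gt0 => /(_ t0).
by rewrite scalerA mulVf ?gt_eqF// scale1r ler_pdivlMl.
Qed.

(** The largest sublinear [q <= p] with [q (x + t *: y) = q x + t * p y] for all
    [t >= 0]; in particular [q (- y) = - p y]. *)
Definition lower_along (p : V -> R) (y x : V) : R :=
  inf [set p (x + t *: y) - t * p y | t in [set t : R | 0 <= t]].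

Section LowerAlong.
Variables (p : V -> R) (y : V) (sp : sublinear_below_norm p).

Let has_lb x :
  has_lbound [set p (x + t *: y) - t * p y | t in [set t : R | 0 <= t]].
Proof.
exists (- `|x|) => _ [t t0 <-].
have [pD _ pn] := sp; have := pD (x + t *: y) (- x).
rewrite addrAC subrr add0r sublinear_homog// => h.
have := pn (- x); rewrite normrN; lra.
Qed.

Lemma lower_along_le x t : 0 <= t ->
  lower_along p y x <= p (x + t *: y) - t * p y.
Proof. by move=> t0; apply: ge_inf => //; exists t. Qed.

Lemma lower_along_glb x c :
  (forall t, 0 <= t -> c <= p (x + t *: y) - t * p y) ->
  c <= lower_along p y x.
Proof.
move=> h; apply: lb_le_inf; first by exists (p (x + 0 *: y) - 0 * p y), 0 => /=.
by move=> _ [t t0 <-]; exact: h.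
Qed.

Lemma lower_along_le_id x : lower_along p y x <= p x.
Proof.
have := @lower_along_le x 0 (lexx _).
by rewrite scale0r mul0r addr0 subr0.
Qed.

Lemma sublinear_lower_along : sublinear_below_norm (lower_along p y).
Proof.
have [pD pZ pn] := sp; split => [a b|s x s0|x].
- rewrite -lerBlDr; apply: lower_along_glb => t t0.
  rewrite lerBlDr -lerBlDl; apply: lower_along_glb => r r0.
  rewrite lerBlDl.
  apply: le_trans (@lower_along_le (a + b) (t + r) (addr_ge0 t0 r0)) _.
  have := pD (a + t *: y) (b + r *: y).
  by rewrite addrACA -scalerDl; lra.
- rewrite -ler_pdivrMl//; apply: lower_along_glb => t t0.
  rewrite ler_pdivrMl//.
  apply: le_trans (@lower_along_le (s *: x) (s * t) (mulr_ge0 (ltW s0) t0)) _.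
  rewrite mulrBr mulrA lerD2r -scalerA -scalerDr; exact: pZ.
- exact: le_trans (lower_along_le_id x) (pn x).
Qed.

End LowerAlong.

(** A minimal sublinear functional equals its lowering along every [y], and
    the bound at [t = 1] is then superadditivity. *)
Lemma minimal_sublinear_linear p : sublinear_below_norm p ->
  (forall q, sublinear_below_norm q -> (forall x, q x <= p x) -> q = p) ->
  linear (p : V -> R^o).
Proof.
move=> sp pmin.
have pD : {morph p : x y / x + y}.
  move=> x y; apply/eqP; rewrite eq_le; have [-> _ _] := sp => //=.
  have := @lower_along_le p y sp x 1 ler01.
  rewrite (pmin _ (sublinear_lower_along y sp)); last exact: lower_along_le_id.
  by rewrite scale1r mul1r; lra.
have pN x : p (- x) = - p x.
  by apply/eqP; rewrite -addr_eq0 -pD addNr sublinear0.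
move=> a x y; rewrite pD; congr (_ + _).
have [a0|a0] := leP 0 a; first exact: sublinear_homog.
by rewrite -[a]opprK scaleNr pN sublinear_homog ?oppr_ge0 ?ltW// scaleNr.
Qed.

(** The infimum of a chain of sublinear functionals is sublinear, so minimal
    ones exist below any given one. *)
Lemma minimal_sublinear_exists p0 : sublinear_below_norm p0 ->
  exists p, [/\ sublinear_below_norm p, forall x, p x <= p0 x &
    forall q, sublinear_below_norm q -> (forall x, q x <= p x) -> q = p].
Proof.
move=> sp0.
pose P p := sublinear_below_norm p /\ forall x, p x <= p0 x.
pose ge (p q : {p | P p}) := `[< forall x, sval q x <= sval p x >].
have [| | | |[p [sp pp0]] pmax] := @Zorn _ ge.
- by move=> p; apply/asboolP.
- move=> p q r /asboolP pq /asboolP qr; apply/asboolP => x.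
  exact: le_trans (qr x) (pq x).
- move=> [p Pp] [q Pq] /asboolP pq /asboolP qp; apply: eq_exist.
  by apply/funext => x; apply/eqP; rewrite eq_le pq qp.
- move=> A totA.
  have [[a Aa]|A0] := pselect (exists a, A a); last first.
    exists (exist P p0 (conj sp0 (fun x => lexx _))) => s As.
    by exfalso; apply: A0; exists s.
  pose S x := [set sval q x | q in A].
  have Slb x : has_lbound (S x).
    exists (- `|x|) => _ [q Aq <-]; apply: sublinear_lbound.
    by case: (svalP q).
  have Sle x q : A q -> inf (S x) <= sval q x.
    by move=> Aq; apply: ge_inf => //; exists q.
  have Sglb x c : (forall q, A q -> c <= sval q x) -> c <= inf (S x).
    move=> h; apply: lb_le_inf; first by exists (sval a x), a.
    by move=> _ [q Aq <-]; exact: h.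
  suff Pinf : P (fun x => inf (S x)).
    by exists (exist P _ Pinf) => s As; apply/asboolP => x /=; exact: Sle.
  split; last first.
    by move=> x; apply: le_trans (Sle x _ Aa) _; case: (svalP a).
  split => [x y|t x t0|x].
  + rewrite -lerBlDr; apply: (Sglb) => q Aq.
    rewrite lerBlDr -lerBlDl; apply: (Sglb) => r Ar; rewrite lerBlDl.
    (* of two members of the chain, use the smaller one at both points *)
    have [/asboolP qr|/asboolP rq] := totA _ _ Aq Ar.
      apply: le_trans (Sle _ _ Ar) _; case: (svalP r) => -[rD _ _] _.
      by apply: le_trans (rD x y) _; rewrite lerD2r.
    apply: le_trans (Sle _ _ Aq) _; case: (svalP q) => -[qD _ _] _.
    by apply: le_trans (qD x y) _; rewrite lerD2l.
  + rewrite -ler_pdivrMl//; apply: (Sglb) => q Aq; rewrite ler_pdivrMl//.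
    apply: le_trans (Sle _ _ Aq) _.
    by case: (svalP q) => -[_ qZ _] _; exact: qZ.
  + apply: le_trans (Sle _ _ Aa) _.
    by case: (svalP a) => -[_ _ an] _; exact: an.
exists p; split => // q sq qp.
have Pq : P q by split => // x; apply: le_trans (qp x) (pp0 x).
have qp' : ge (exist P p (conj sp pp0)) (exist P q Pq) by apply/asboolP.
by case: (pmax _ qp').
Qed.

Lemma dual_norm_le (phi : {scalar V}) x :
  dual_sphere phi -> phi x <= `|x|.
Proof.
move=> [_ phi1].
have sphi : has_sup [set `|phi x| | x in [set x : V | `|x| <= 1]].
  apply: contrapT => /sup_out; move: phi1; rewrite /dual_norm => ->.
  by move/eqP; rewrite oner_eq0.
have [->|x0] := eqVneq x 0; first by rewrite linear0 normr0.
have nx : 0 < `|x| by rewrite normr_gt0.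
have : `|phi (`|x|^-1 *: x)| <= 1.
  rewrite -phi1; apply: ub_le_sup; first by case: sphi.
  exists (`|x|^-1 *: x) => //=.
  by rewrite normrZ normfV normr_id mulVf ?gt_eqF.
rewrite linearZ /= normrM normfV normr_id ler_pdivrMl// mulr1.
exact: le_trans (ler_norm _).
Qed.

(** Hahn-Banach, in the form of a norming functional: a minimal sublinear
    functional below the norm lowered along [v] is linear, and lowering along
    [v] pins its value at [- v]. *)
Lemma norming_functional (v : V) : v != 0 ->
  exists2 phi : {scalar V}, dual_sphere phi & phi v = `|v|.
Proof.
move=> v0.
have [p [sp ple pmin]] :=
  minimal_sublinear_exists (sublinear_lower_along v sublinear_norm).
have plin := minimal_sublinear_linear sp pmin.
pose pL := GRing.isLinear.Build _ _ _ _ p plin.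
pose phi : {scalar V} := HB.pack p pL.
have phiE x : phi x = p x by [].
have pv : phi v = `|v|.
  apply/eqP; rewrite eq_le phiE; case: (sp) => _ _ -> /=.
  have pN : p (- v) = - p v by rewrite -!phiE linearN.
  rewrite -lerN2 -pN.
  apply: le_trans (ple _) _.
  apply: le_trans (lower_along_le v sublinear_norm (- v) ler01) _.
  by rewrite scale1r addNr normr0 mul1r add0r.
have pabs x : `|phi x| <= `|x|.
  rewrite ler_norml phiE sublinear_lbound//=; by case: (sp).
exists phi => //; split.
  move=> x; apply/cvgrPdist_lt => e e0; near=> z.
  rewrite -linearB; apply: le_lt_trans (pabs _) _.
  by near: z; exact: cvgr_dist_lt.
have nv : 0 < `|v| by rewrite normr_gt0.
apply/eqP; rewrite /dual_norm eq_le; apply/andP; split.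
  apply: ge_sup; first by exists `|phi 0|, 0 => //=; rewrite normr0.
  by move=> _ [x /= x1 <-]; exact: le_trans (pabs x) x1.
apply: ub_le_sup; first by exists 1 => _ [x /= x1 <-]; exact: le_trans (pabs x) x1.
exists (`|v|^-1 *: v).
  by rewrite /= normrZ normfV normr_id mulVf ?gt_eqF.
rewrite (_ : phi _ = `|v|^-1 * phi v); last by rewrite linearZ.
by rewrite pv mulVf ?gt_eqF// normr1.
Unshelve. all: by end_near. Qed.

End HahnBanach.

(** * Scale-free forms of the two rotundity properties *)

Lemma cvg_natoo (g : nat -> nat) :
  (forall k, (k <= g k)%N) -> g k @[k --> \oo] --> \oo.
Proof.
move=> gk A [N _ NA]; exists N => // k /= Nk.
by apply: NA => /=; exact: leq_trans (gk k).
Qed.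

Section Normalization.
Context {R : realType} (V : normedModType R).
Implicit Types (x : V) (u v : nat -> V).

Lemma norm_unit x : x != 0 -> `| `|x|^-1 *: x| = 1.
Proof. by move=> x0; rewrite normrZ normfV normr_id mulVf ?normr_eq0. Qed.

Lemma cvg_norm_normalize x v : x != 0 -> (forall n, v n != 0) ->
  `|v n| @[n --> \oo] --> `|x| ->
  `|v n + x| @[n --> \oo] --> 2 * `|x| ->
  `| `|v n|^-1 *: v n + `|x|^-1 *: x| @[n --> \oo] --> (2 : R).
Proof.
move=> x0 v0 vx vpx.
have nx : `|x| != 0 by rewrite normr_eq0.
have nv n : `|v n| != 0 by rewrite normr_eq0.
apply: (@squeeze_cvgr _ _ _ _
  (fun n => `|x|^-1 * `|v n + x| - `| `|v n|^-1 - `|x|^-1| * `|v n|)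
  (fun=> 2)); last exact: cvg_cst.
- apply: nearW => n; apply/andP; split; last first.
    by apply: le_trans (ler_normD _ _) _; rewrite !norm_unit.
  rewrite lerBlDr.
  have -> : `|x|^-1 * `|v n + x| = `|(`|v n|^-1 *: v n + `|x|^-1 *: x)
      - (`|v n|^-1 - `|x|^-1) *: v n|.
    rewrite -[X in X * _]ger0_norm ?invr_ge0// -normrZ; congr (`|_|).
    by rewrite scalerBl opprB [X in _ = _ + X]addrC addrACA subrr add0r scalerDr addrC.
  by apply: le_trans (ler_normB _ _) _; rewrite normrZ.
- have -> : (2 : R) = `|x|^-1 * (2 * `|x|) - `| `|x|^-1 - `|x|^-1| * `|x|.
    by rewrite subrr normr0 mul0r subr0 mulrCA mulVf// mulr1.
  apply: cvgB; first by apply: cvgM => //; exact: cvg_cst.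
  apply: cvgM => //; apply: cvg_norm; apply: cvgB; last exact: cvg_cst.
  exact: cvgV.
Qed.

Lemma cvg_norm_neq0 x u : x != 0 -> `|u n| @[n --> \oo] --> `|x| ->
  exists N, forall n, (N <= n)%N -> u n != 0.
Proof.
move=> x0 ux.
have : \forall n \near \oo, 0 < `|u n|.
  by apply: (cvgr_gt _ ux); rewrite normr_gt0.
by case=> N _ NP; exists N => n Nn; rewrite -normr_gt0; exact: NP.
Qed.

(** Only the terms with [u n != 0] can be normalized, whence the shift. *)
Lemma LUR_scaled x u : LUR V -> `|u n| @[n --> \oo] --> `|x| ->
  `|u n + x| @[n --> \oo] --> 2 * `|x| ->
  `|u n - x| @[n --> \oo] --> (0 : R).
Proof.
move=> lur ux upx.
have [x0|x0] := eqVneq x 0.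
  by move: ux; rewrite x0 normr0; under eq_fun do rewrite -[u _]subr0.
have [N uN] := cvg_norm_neq0 x0 ux.
rewrite -(cvg_shiftn N) /=; pose v n := u (n + N)%N.
have v0 n : v n != 0 by apply: uN; exact: leq_addl.
have vx : `|v n| @[n --> \oo] --> `|x|.
  by move: ux; rewrite -(cvg_shiftn N).
have vpx : `|v n + x| @[n --> \oo] --> 2 * `|x|.
  by move: upx; rewrite -(cvg_shiftn N).
have := lur _ _ (norm_unit x0) (fun n => norm_unit (v0 n))
  (cvg_norm_normalize x0 v0 vx vpx).
set w := fun n => `|v n|^-1 *: v n - `|x|^-1 *: x => w0.
apply: (@squeeze_cvgr _ _ _ _ (fun=> 0)
  (fun n => `|v n| * `|w n| + `| `|v n| - `|x| |)).
- apply: nearW => n; rewrite normr_ge0 /=.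
  have -> : u (n + N)%N - x = `|v n| *: w n + (`|v n| - `|x|) *: (`|x|^-1 *: x).
    rewrite /w scalerBr scalerBl scalerA mulfV ?normr_eq0// scale1r.
    by rewrite addrA subrK scalerA mulfV ?normr_eq0// scale1r.
  apply: le_trans (ler_normD _ _) _.
  by rewrite 2!normrZ norm_unit// normr_id mulr1.
- exact: cvg_cst.
- have -> : (0 : R) = `|x| * 0 + `| `|x| - `|x| |.
    by rewrite mulr0 subrr normr0 addr0.
  apply: cvgD; first exact: cvgM.
  by apply: cvg_norm; apply: cvgB => //; exact: cvg_cst.
Qed.

(** The functional-free content of alternative convexity or smoothness: near
    the points [u n] the norm decreases in the direction [- x] with slope almost
    [`|x|], uniformly in [n]. Were it to fail, functionals norming
    [u n - t *: x] with [t] tending to 0 would violate the definition. *)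
Lemma sluacs_slope x u (e : R) : sluacs V -> 0 < e ->
  `|u n| @[n --> \oo] --> `|x| ->
  `|u n + x| @[n --> \oo] --> 2 * `|x| ->
  exists k, forall n, (k <= n)%N ->
    `|u n - k.+1%:R^-1 *: x| <= `|u n| - k.+1%:R^-1 * ((1 - e) * `|x|).
Proof.
move=> acs e0 ux upx.
have [x0|x0] := eqVneq x 0.
  by exists 0%N => n _; rewrite x0 scaler0 normr0 !mulr0 !subr0.
have [N uN] := cvg_norm_neq0 x0 ux.
apply: contrapT => no_k.
have /choice[g gP] k : exists n, (k + N <= n)%N /\
    `|u n| - (k + N).+1%:R^-1 * ((1 - e) * `|x|)
      < `|u n - (k + N).+1%:R^-1 *: x|.
  apply: contrapT => no_n; apply: no_k; exists (k + N)%N => n kn.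
  by rewrite leNgt; apply/negP => h; apply: no_n; exists n.
pose t k : R := (k + N).+1%:R^-1.
have t_gt0 k : 0 < t k by rewrite invr_gt0 ltr0n.
pose v k := u (g k).
have goo : g k @[k --> \oo] --> \oo.
  by apply: cvg_natoo => k; apply: leq_trans (gP k).1; exact: leq_addr.
have v0 k : v k != 0 by apply: uN; apply: leq_trans (gP k).1; exact: leq_addl.
have vx : `|v k| @[k --> \oo] --> `|x| by exact: cvg_comp goo ux.
have vpx : `|v k + x| @[k --> \oo] --> 2 * `|x| by exact: cvg_comp goo upx.
have viol k : `|v k| - t k * ((1 - e) * `|x|) < `|v k - t k *: x|.
  exact: (gP k).2.
have nx : 0 < `|x| by rewrite normr_gt0.
have /choice[phi phiP] k : exists phi : {scalar V},
    dual_sphere phi /\ phi (v k - t k *: x) = `|v k - t k *: x|.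
  have vtx : v k - t k *: x != 0.
    apply/eqP => h; have := viol k; rewrite h normr0.
    move/eqP: h; rewrite subr_eq0 => /eqP ->.
    rewrite normrZ gtr0_norm// -mulrBr pmulr_rlt0//.
    by rewrite mulrBl mul1r opprB addrC subrK pmulr_rlt0// ltNge (ltW nx).
  by have [psi ps pE] := norming_functional vtx; exists psi.
have phiB k : phi k (v k) = `|v k - t k *: x| + t k * phi k x.
  by rewrite -(phiP k).2 linearB linearZ /= subrK.
have phi_le k y : phi k y <= `|y| by exact: dual_norm_le (phiP k).1.
have phi_ge k y : - `|y| <= phi k y.
  by rewrite lerNl -linearN (le_trans (phi_le _ _))// normrN.
have t0 : t k @[k --> \oo] --> (0 : R).
  have := @cvg_harmonic R; rewrite -(cvg_shiftn N); exact.
have phiZ k a y : phi k (a *: y) = a * phi k y by rewrite linearZ.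
have phix k : phi k (`|x|^-1 *: x) <= 1 - e.
  rewrite phiZ ler_pdivrMl// mulrC -(ler_pM2l (t_gt0 k)).
  have := viol k; have := phi_le k (v k); rewrite phiB; lra.
have phiv : phi k (`|v k|^-1 *: v k) @[k --> \oo] --> (1 : R).
  apply: (@squeeze_cvgr _ _ _ _
    (fun k => 1 - `|v k|^-1 * (2 * t k * `|x|)) (fun=> 1)).
  - apply: nearW => k; have nv : 0 < `|v k| by rewrite normr_gt0.
    rewrite (le_trans (phi_le _ _)) ?norm_unit// andbT.
    rewrite phiZ -[X in X - _](@mulVf _ `|v k|) ?gt_eqF// -mulrBr.
    rewrite ler_pM2l ?invr_gt0// phiB.
    have h1 : `|v k| <= `|v k - t k *: x| + t k * `|x|.
      rewrite -{2}(gtr0_norm (t_gt0 k)) -normrZ.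
      by rewrite -[X in `|X| <= _](subrK (t k *: x)) ler_normD.
    have h2 : - (t k * `|x|) <= t k * phi k x.
      by rewrite -mulrN ler_pM2l.
    lra.
  - have v1 : `|v k|^-1 @[k --> \oo] --> `|x|^-1 by apply: cvgV; rewrite ?gt_eqF.
    have t1 : 2 * t k * `|x| @[k --> \oo] --> 2 * 0 * `|x|.
      apply: cvgM; last exact: cvg_cst.
      by apply: cvgM => //; exact: cvg_cst.
    have := cvgB (@cvg_cst _ (1 : R) _ _ _) (cvgM v1 t1).
    by rewrite mulr0 mul0r mulr0 subr0; exact.
  - exact: cvg_cst.
have phix1 := acs _ _ phi (norm_unit x0) (fun n => norm_unit (v0 n))
  (fun k => (phiP k).1) (cvg_norm_normalize x0 v0 vx vpx) phiv.
have : 1 <= 1 - e :> R.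
  by apply: (cvgr_to_le phix1); apply: nearW.
lra.
Qed.

(** Along the segment from [v] to [v - t *: x] the norm is convex, so a slope
    bound at [t] persists for smaller [t]. *)
Lemma slope_le (v x : V) (s t c : R) : 0 <= s -> s <= t -> 0 < t ->
  `|v - t *: x| <= `|v| - t * c -> `|v - s *: x| <= `|v| - s * c.
Proof.
move=> s0 st t0 h.
have -> : v - s *: x = (1 - s / t) *: v + (s / t) *: (v - t *: x).
  rewrite scalerBr scalerA divfK ?gt_eqF// addrA -scalerDl subrK.
  by rewrite scale1r.
have st1 : s / t <= 1 by rewrite ler_pdivrMr// mul1r.
have st0 : 0 <= s / t by rewrite divr_ge0// ltW.
apply: le_trans (ler_normD _ _) _; rewrite 2!normrZ.
rewrite (ger0_norm st0) ger0_norm ?subr_ge0//.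
have := ler_wpM2l st0 h; rewrite mulrBr mulrA divfK ?gt_eqF//; lra.
Qed.

End Normalization.

(** * Representatives of classes and the lattice norm *)

Section FunctionSpace.
Context d (T : measurableType d) (R : realType).
Context (mu : {measure set T -> \bar R}) (X : normedModType R).
Context (F : function_space mu X).
Implicit Types f g : T -> X.

Local Open Scope quotient_scope.

Definition class_of f (Ff : fmem F f) : fclass F :=
  \pi_(fclass F) (FSub (mem_set Ff : f \in fpred F)).

Lemma class_of_surj (c : fclass F) :
  exists f, exists Ff : fmem F f, c = class_of Ff.
Proof.
elim/quotW: c => -[f mf]; have Ff := set_mem mf.
by exists f, Ff; congr \pi; exact: val_inj.
Qed.

Lemma norm_class_of f (Ff : fmem F f) : `|class_of Ff| = fnorm F f.
Proof. by rewrite norm_fclassE. Qed.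

Lemma norm_class_ofD f g (Ff : fmem F f) (Fg : fmem F g) :
  `|class_of Ff + class_of Fg| = fnorm F (fun t => f t + g t).
Proof.
have -> : class_of Ff + class_of Fg = \pi_(fclass F)
    (FSub (mem_set Ff : f \in fpred F) + FSub (mem_set Fg : g \in fpred F)).
  by rewrite (Quotient.pi_add (aezero F)).
by rewrite norm_fclassE.
Qed.

Lemma class_ofZ (a : R) f (Ff : fmem F f) :
  a *: class_of Ff = class_of (fmemZ a Ff).
Proof.
rewrite [LHS]/(fclass_scale _ _); apply/fclass_eqP.
have : {ae mu, forall t, (repr (class_of Ff) : fsub F) t =
    (FSub (mem_set Ff : f \in fpred F) : fsub F) t}.
  by apply/fclass_eqP; rewrite reprK.
by apply: filterS => t /= /(congr1 ( *:%R a)).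
Qed.

Lemma fmemB f g : fmem F f -> fmem F g -> fmem F (fun t => f t - g t).
Proof.
move=> Ff Fg; have := fmemD Ff (fmemZ (-1) Fg).
by under eq_fun do rewrite scaleN1r.
Qed.

Lemma norm_class_ofB f g (Ff : fmem F f) (Fg : fmem F g) :
  `|class_of Ff - class_of Fg| = fnorm F (fun t => f t - g t).
Proof.
rewrite -scaleN1r class_ofZ norm_class_ofD; congr fnorm.
by apply/funext => t; rewrite scaleN1r.
Qed.

Lemma fnorm_ge0 f : fmem F f -> 0 <= fnorm F f.
Proof. by move=> Ff; rewrite -(norm_class_of Ff). Qed.

Lemma fnormBC f g : fmem F f -> fmem F g ->
  fnorm F (fun t => f t - g t) = fnorm F (fun t => g t - f t).
Proof.
by move=> Ff Fg; rewrite -(norm_class_ofB Ff Fg) distrC norm_class_ofB.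
Qed.

Lemma LUR_fun f (h : nat -> T -> X) : LUR (fclass F) ->
  fmem F f -> (forall n, fmem F (h n)) ->
  fnorm F (h n) @[n --> \oo] --> fnorm F f ->
  fnorm F (fun t => h n t + f t) @[n --> \oo] --> 2 * fnorm F f ->
  fnorm F (fun t => h n t - f t) @[n --> \oo] --> (0 : R).
Proof.
move=> lur Ff Fh hf hpf.
under eq_fun do rewrite -(norm_class_ofB (Fh _) Ff).
apply: LUR_scaled => //.
  by under eq_fun do rewrite norm_class_of; rewrite norm_class_of.
by under eq_fun do rewrite norm_class_ofD; rewrite norm_class_of.
Qed.

End FunctionSpace.

Section KotheSpace.
Context d (T : measurableType d) (R : realType).
Context (mu : {measure set T -> \bar R}) (E : kothe_space mu).
Implicit Types (f g w : T -> R) (h : nat -> T -> R) (A : set T).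

Let kothe_fnormD f g : fmem E f -> fmem E g ->
  fnorm E (fun t => f t + g t) <= fnorm E f + fnorm E g.
Proof. exact: fnormD. Qed.

Lemma kothe_le f g : fmem E f -> measurable_fun setT g ->
  (forall t, `|g t| <= `|f t|) -> fmem E g /\ fnorm E g <= fnorm E f.
Proof. by move=> Ef mg gf; apply: kothe_ideal => //; exact: aeW. Qed.

Lemma kothe_norm_ae_eq f g : fmem E f -> fmem E g ->
  {ae mu, forall t, f t = g t} -> fnorm E f = fnorm E g.
Proof.
move=> Ef Eg fg; apply/eqP; rewrite eq_le; apply/andP; split.
  apply: (kothe_ideal Eg (kothe_measurable Ef) _).2.
  by apply: filterS fg => t ->.
apply: (kothe_ideal Ef (kothe_measurable Eg) _).2.
by apply: filterS fg => t ->.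
Qed.

(** How norm convergence yields almost everywhere statements: a function
    dominated by members of [E] of arbitrarily small norm is null. *)
Lemma kothe_ae0 w : measurable_fun setT w ->
  (forall e : R, 0 < e -> exists v, [/\ fmem E v, fnorm E v < e &
     {ae mu, forall t, `|w t| <= `|v t|}]) ->
  {ae mu, forall t, w t = 0}.
Proof.
move=> mw small.
have Ew : fmem E w.
  by have [v [Ev _ wv]] := small 1 ltr01; have [] := kothe_ideal Ev mw wv.
apply/(fnorm_eq0 Ew)/eqP; rewrite eq_le fnorm_ge0// andbT.
apply/ler_addgt0Pl => e e0; rewrite addr0.
have [v [Ev ve wv]] := small e e0; have [_ wle] := kothe_ideal Ev mw wv.
exact: le_trans wle (ltW ve).
Qed.

Lemma kothe_cauchy_cvg h : (forall n, fmem E (h n)) ->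
  (forall e : R, 0 < e -> exists N, forall n, (N <= n)%N ->
     fnorm E (fun t => h n t - h N t) < e) ->
  exists2 g, fmem E g &
    fnorm E (fun t => h n t - g t) @[n --> \oo] --> (0 : R).
Proof.
move=> Eh hC; pose c n := class_of (Eh n).
have /kothe_complete cc : cauchy (c n @[n --> \oo]).
  apply: cauchy_exP => e e0; have [N hN] := hC e e0.
  exists (c N); exists N => // n /= /hN.
  by rewrite -ball_normE /= distrC norm_class_ofB.
have [g [Eg lg]] := class_of_surj (lim (c n @[n --> \oo])).
exists g => //.
have cg : c n @[n --> \oo] --> class_of Eg by rewrite -lg; exact: cc.
under eq_fun do rewrite -(norm_class_ofB (Eh _) Eg).
have -> : (0 : R) = `|class_of Eg - class_of Eg| by rewrite subrr normr0.
by apply: cvg_norm; apply: cvgB => //; exact: cvg_cst.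
Qed.

Lemma kothe_cvg_lt h g (e : R) : 0 < e ->
  fnorm E (fun t => h n t - g t) @[n --> \oo] --> (0 : R) ->
  exists N, forall n, (N <= n)%N -> fnorm E (fun t => h n t - g t) < e.
Proof. by move=> e0 /cvgr_lt/(_ e e0)[N _ NP]; exists N. Qed.

(** If [fnorm (h k) <= 4 ^- k] then [\sum_k 2 ^ k * h k] converges in [E], and
    its finite-valued sum [g] bounds [h k] by [2 ^- k * g] almost everywhere. *)
Lemma kothe_cvg0_ae_subseq h : (forall n, fmem E (h n)) ->
  (forall n t, 0 <= h n t) -> fnorm E (h n) @[n --> \oo] --> (0 : R) ->
  exists2 s : nat -> nat, forall n, (n <= s n)%N &
    {ae mu, forall t, h (s n) t @[n --> \oo] --> (0 : R)}.
Proof.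
move=> Eh h0 hcvg.
have /choice[s sP] k : exists n, (k <= n)%N /\ fnorm E (h n) < 4^-1 ^+ k.
  have p0 : 0 < 4^-1 ^+ k :> R by rewrite exprn_gt0.
  have [N _ NP] := cvgr_lt _ hcvg _ p0.
  exists (maxn k N); split; first exact: leq_maxl.
  by apply: NP => /=; exact: leq_maxr.
exists s => [n|]; first exact: (sP n).1.
pose S n t : R := \sum_(k < n) 2 ^+ k * h (s k) t.
have SS n t : S n.+1 t = S n t + 2 ^+ n *: h (s n) t by rewrite /S big_ord_recr.
have ES n : fmem E (S n).
  elim: n => [|n IH].
    rewrite (_ : S 0%N = fun=> 0); first exact: fmem0.
    by apply/funext => t; rewrite /S big_ord0.
  by rewrite (funext (SS n)); apply: fmemD => //; exact: fmemZ.
have Sstep n p : fnorm E (fun t => S (n + p)%N t - S n t)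
    <= 2 * (2^-1 ^+ n - 2^-1 ^+ (n + p)).
  elim: p => [|p IH].
    rewrite addn0 subrr mulr0.
    rewrite (_ : (fun t => _) = fun t => 0 *: S n t).
      by rewrite fnormZ// normr0 mul0r.
    by apply/funext => t; rewrite subrr scale0r.
  rewrite addnS; apply: (@le_trans _ _ (fnorm E (fun t => S (n + p)%N t - S n t)
      + fnorm E (fun t => 2 ^+ (n + p) *: h (s (n + p)%N) t))).
    rewrite (_ : (fun t => _) = fun t => (S (n + p)%N t - S n t) +
      2 ^+ (n + p) *: h (s (n + p)%N) t).
      by apply: kothe_fnormD; [exact: fmemB|exact: fmemZ].
    by apply/funext => t; rewrite SS addrAC.
  have : fnorm E (fun t => 2 ^+ (n + p) *: h (s (n + p)%N) t)
      <= 2^-1 ^+ (n + p).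
    rewrite fnormZ// ger0_norm ?exprn_ge0//.
    have -> : 2^-1 ^+ (n + p) = 2 ^+ (n + p) * 4^-1 ^+ (n + p) :> R.
      by rewrite -exprMn; congr (_ ^+ _); lra.
    by rewrite ler_wpM2l ?exprn_ge0// ltW// (sP (n + p)%N).2.
  rewrite exprS; lra.
have p0 : (2^-1 : R) ^+ n @[n --> \oo] --> (0 : R).
  by apply: cvg_expr; rewrite ger0_norm; lra.
have [g Eg Sg] : exists2 g, fmem E g &
    fnorm E (fun t => S n t - g t) @[n --> \oo] --> (0 : R).
  apply: kothe_cauchy_cvg => // e e0.
  have e20 : 0 < e / 2 by lra.
  have [N _ NP] := cvgr_lt _ p0 _ e20.
  exists N => n Nn; rewrite -(subnKC Nn); apply: le_lt_trans (Sstep _ _) _.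
  have := NP N (leqnn N); have : 0 <= (2^-1 : R) ^+ (N + (n - N)).
    by rewrite exprn_ge0.
  lra.
have Smono n m t : (n <= m)%N -> S n t <= S m t.
  move=> nm; rewrite -(subnKC nm); elim: (m - n)%N => [|p IH].
    by rewrite addn0.
  rewrite addnS SS; apply: le_trans IH _.
  by rewrite lerDl mulr_ge0// exprn_ge0.
have Sle : {ae mu, forall t, forall n, S n t <= g t}.
  apply: ae_foralln => n.
  suff : {ae mu, forall t, Num.max (S n t - g t) 0 = 0}.
    by apply: filterS => t /max_idPr; rewrite subr_le0.
  apply: kothe_ae0.
    apply: measurable_maxr; last exact: measurable_cst.
    exact: (kothe_measurable (fmemB (ES n) Eg)).
  move=> e e0; have [N NP] := kothe_cvg_lt e0 Sg.
  exists (fun t => S (maxn n N) t - g t); split; first exact: fmemB.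
    by apply: NP; exact: leq_maxr.
  apply: aeW => t; rewrite ger0_norm ?le_max ?lexx ?orbT//.
  rewrite ge_max normr_ge0 andbT; apply: le_trans (ler_norm _).
  by rewrite lerD2r Smono// leq_maxl.
apply: filterS Sle => t Sgt.
apply: (@squeeze_cvgr _ _ _ _ (fun=> 0) (fun n => 2^-1 ^+ n * g t)).
- apply: nearW => n; rewrite h0 /=.
  have S0 : 0 <= S n t by apply: sumr_ge0 => k _; rewrite mulr_ge0// exprn_ge0.
  rewrite exprVn ler_pdivlMl ?exprn_gt0//; apply: le_trans (Sgt n.+1).
  by rewrite SS lerDr.
- exact: cvg_cst.
- have -> : (0 : R) = 0 * g t by rewrite mul0r.
  by apply: cvgM => //; exact: cvg_cst.
Qed.

(** * Order continuity of locally uniformly rotund norms *)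

(** The lattice structure supplies the midpoint hypothesis of rotundity: as
    [2 * h n <= h n + f], convergence of the norms alone is enough. *)
Lemma LUR_dominated f h : LUR (fclass E) -> fmem E f ->
  (forall n, measurable_fun setT (h n)) -> (forall n t, 0 <= h n t <= f t) ->
  fnorm E (h n) @[n --> \oo] --> fnorm E f ->
  fnorm E (fun t => h n t - f t) @[n --> \oo] --> (0 : R).
Proof.
move=> lur Ef mh hf hcvg.
have f0 t : 0 <= f t by have /andP[a b] := hf 0%N t; exact: le_trans b.
have Eh n : fmem E (h n).
  apply: (kothe_le Ef (mh n) _).1 => t; have /andP[a b] := hf n t.
  by rewrite !ger0_norm.
apply: LUR_fun => //.
apply: (@squeeze_cvgr _ _ _ _ (fun n => 2 * fnorm E (h n))
  (fun n => fnorm E (h n) + fnorm E f)).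
- apply: nearW => n; rewrite kothe_fnormD// andbT.
  rewrite -[2]gtr0_norm// -fnormZ//.
  apply: (kothe_le _ _ _).2; first exact: fmemD.
    exact: (kothe_measurable (fmemZ 2 (Eh n))).
  move=> t; have /andP[a b] := hf n t.
  rewrite ger0_norm; last by rewrite mulr_ge0.
  rewrite ger0_norm; last exact: addr_ge0.
  by rewrite -[leLHS]/(2 * h n t); lra.
- by apply: cvgM => //; exact: cvg_cst.
- have -> : 2 * fnorm E f = fnorm E f + fnorm E f by lra.
  by apply: cvgD => //; exact: cvg_cst.
Qed.

End KotheSpace.

Section OrderContinuity.
Context d (T : measurableType d) (R : realType).
Context (mu : {measure set T -> \bar R}) (E : kothe_space mu).
Implicit Types (f : T -> R) (A B : set T).

Definition cut f A : T -> R := fun t => f t * \1_A t.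

Lemma cut_in f A t : A t -> cut f A t = f t.
Proof. by move=> At; rewrite /cut indicE mem_set// mulr1. Qed.

Lemma cut_out f A t : ~ A t -> cut f A t = 0.
Proof. by move=> At; rewrite /cut indicE memNset// mulr0. Qed.

Lemma measurable_cut f A : measurable_fun setT f -> measurable A ->
  measurable_fun setT (cut f A).
Proof. by move=> mf mA; apply: measurable_funM => //; exact: measurable_indic. Qed.

Lemma cut_le_norm f A B t : A `<=` B -> `|cut f A t| <= `|cut f B t|.
Proof.
move=> AB; have [At|At] := pselect (A t); first by rewrite !cut_in//; exact: AB.
by rewrite (cut_out _ At) normr0.
Qed.

Lemma fmem_cut f A : fmem E f -> measurable A -> fmem E (cut f A).
Proof.
move=> Ef mA; apply: (kothe_le Ef (measurable_cut (kothe_measurable Ef) mA) _).1.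
move=> t; have [At|At] := pselect (A t); first by rewrite cut_in.
by rewrite cut_out// normr0.
Qed.

Lemma fnorm_cut_le f A B : fmem E f -> measurable A -> measurable B ->
  A `<=` B -> fnorm E (cut f A) <= fnorm E (cut f B).
Proof.
move=> Ef mA mB AB; apply: (kothe_le (fmem_cut Ef mB) _ _).2.
  exact: kothe_measurable (fmem_cut Ef mA).
by move=> t; exact: cut_le_norm.
Qed.

Lemma cutB f A B : A `<=` B ->
  (fun t => cut f B t - cut f A t) = cut f (B `\` A).
Proof.
move=> AB; apply/funext => t; have [At|At] := pselect (A t).
  by rewrite (cut_in _ At) (cut_in _ (AB _ At)) subrr cut_out// => -[].
rewrite (cut_out _ At) subr0.
have [Bt|Bt] := pselect (B t); first by rewrite !cut_in.
by rewrite !cut_out// => -[].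
Qed.

Lemma uncountable_reals : ~ countable [set: R].
Proof.
move=> cR; have := countable_lebesgue_measure0 (sub_countable
  (subset_card_le (@subsetT _ `[0%R, 1%R]%classic)) cR).
rewrite lebesgue_measure_itv /= lte_fin ltr01 => -[] /eqP.
by rewrite subr0 oner_eq0.
Qed.

(** Cut [f] to the union [B r] of the pieces indexed by the rationals below [r].
    The norms of these cuts increase in [r], so they have only countably many
    jumps, and are left-continuous at some [r]. There rotundity makes the norm of
    the cut to [B r `\` B s] small as [s] increases to [r], although this set
    always contains a whole piece. *)
Lemma LUR_no_large_pieces f (D : nat -> set T) (c : R) : LUR (fclass E) ->
  fmem E f -> (forall t, 0 <= f t) -> (forall j, measurable (D j)) ->
  trivIset setT D -> 0 < c -> (forall j, c <= fnorm E (cut f (D j))) -> False.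
Proof.
move=> lur Ef f0 mD tD c0 large.
pose B (r : R) := \bigcup_(j in [set pickle q | q in [set q : rat | ratr q < r]]) D j.
have mB r : measurable (B r) by apply: bigcup_measurable => j _; exact: mD.
have subB r s : r <= s -> B r `<=` B s.
  move=> rs t [_ [q /= qr <-] Dt]; exists (pickle q) => //; exists q => //=.
  exact: lt_le_trans qr rs.
pose G r := fnorm E (cut f (B r)).
have Gle r s : r <= s -> G r <= G s.
  by move=> rs; apply: fnorm_cut_le => //; exact: subB.
(* a rational between [s] and [r] indexes a piece inside [B r `\` B s] *)
have gap r s : s < r -> c <= fnorm E (fun t => cut f (B s) t - cut f (B r) t).
  move=> sr; have [p] := rat_in_itvoo sr; rewrite in_itv /= => /andP[sp pr].
  rewrite fnormBC; [|exact: fmem_cut..].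
  rewrite cutB; last exact/subB/ltW.
  apply: le_trans (large (pickle p)) _; apply: fnorm_cut_le => //.
    exact: measurableD.
  move=> t Dt; split; first by exists (pickle p) => //; exists p.
  move=> [_ [q /= qs <-] Dqt].
  have /(pcan_inj pickleK) pq : pickle p = pickle q by apply: tD => //; exists t.
  by move: qs; rewrite -pq ltNge (ltW sp).
(* a jump at every [r] would inject the reals into the rationals *)
have /choice[q qP] r : exists q : rat,
    (forall s, s < r -> G s <= ratr q) /\ ratr q < G r.
  pose L := sup [set G s | s in [set s : R | s < r]].
  have Lub : has_sup [set G s | s in [set s : R | s < r]].
    split; first by exists (G (r - 1)), (r - 1) => //=; lra.
    by exists (G r) => _ [s /= sr <-]; exact/Gle/ltW.
  have LG : L <= G r.
    by apply: ge_sup; [case: Lub|move=> _ [s /= sr <-]; exact/Gle/ltW].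
  have GL s : s < r -> G s <= L.
    by move=> sr; apply: ub_le_sup; [case: Lub|exists s].
  move: LG; rewrite le_eqVlt => /orP[/eqP LG|LG]; last first.
    have [p] := rat_in_itvoo LG; rewrite in_itv /= => /andP[Lp pG].
    by exists p; split => // s sr; apply: le_trans (GL s sr) (ltW Lp).
  exfalso.
  have /choice[s sP] n : exists s, s < r /\ G r - n.+1%:R^-1 < G s.
    have n0 : 0 < n.+1%:R^-1 :> R by rewrite invr_gt0 ltr0n.
    have [_ [s /= sr <-]] := sup_adherent n0 Lub.
    by rewrite -/L LG => h; exists s.
  have : fnorm E (fun t => cut f (B (s n)) t - cut f (B r) t)
      @[n --> \oo] --> (0 : R).
    apply: LUR_dominated => //; first exact: fmem_cut.
    - move=> n; exact: kothe_measurable (fmem_cut Ef (mB _)).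
    - move=> n t; have [Bt|Bt] := pselect (B (s n) t).
        by rewrite !cut_in// ?f0 ?lexx//; exact: subB (ltW (sP n).1) _ Bt.
      rewrite (cut_out _ Bt) lexx /=.
      by rewrite /cut mulr_ge0// indicE ler0n.
    - apply: (@squeeze_cvgr _ _ _ _ (fun n => G r - n.+1%:R^-1) (fun=> G r)).
      + apply: nearW => n; rewrite ltW ?(sP n).2//=.
        exact/Gle/ltW/(sP n).1.
      + have := cvgB (@cvg_cst _ (G r) _ _ _) (@cvg_harmonic R).
        by rewrite subr0; exact.
      + exact: cvg_cst.
  move=> /cvgr_lt/(_ c c0)[N _ /(_ N (leqnn N))] /=.
  by rewrite ltNge gap// (sP N).1.
apply: uncountable_reals; apply/countable_injP; exists (pickle \o q).
have qlt r s : r < s -> (ratr (q r) : R) < ratr (q s).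
  by move=> rs; apply: lt_le_trans (qP r).2 _; exact: (qP s).1.
move=> r s _ _ /= /(pcan_inj pickleK) qrs.
have [rs|sr|//] := ltgtP r s.
  by have := qlt _ _ rs; rewrite qrs ltxx.
by have := qlt _ _ sr; rewrite qrs ltxx.
Qed.

(** If the cuts to [A n] were not Cauchy, the increments would contain a disjoint
    sequence of pieces of large norm; and when they converge, the limit can only
    be [f]. *)
Lemma LUR_order_continuous f (A : nat -> set T) : LUR (fclass E) ->
  fmem E f -> (forall t, 0 <= f t) -> (forall n, measurable (A n)) ->
  {homo A : m n / (m <= n)%N >-> m `<=` n} ->
  {ae mu, forall t, exists n, A n t} ->
  fnorm E (cut f (~` A n)) @[n --> \oo] --> (0 : R).
Proof.
move=> lur Ef f0 mA ndA covA.
have Ecut n : fmem E (cut f (A n)) by exact: fmem_cut.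
have [g Eg Ag] : exists2 g, fmem E g &
    fnorm E (fun t => cut f (A n) t - g t) @[n --> \oo] --> (0 : R).
  apply: kothe_cauchy_cvg => // c c0; apply: contrapT => noN.
  have /choice[m mP] N : exists m, (N <= m)%N /\
      c <= fnorm E (cut f (A m `\` A N)).
    apply: contrapT => nom; apply: noN; exists N => m Nm.
    rewrite cutB; last exact: ndA.
    by rewrite ltNge; apply/negP => cm; apply: nom; exists m.
  pose k j := iter j m 0%N.
  pose D j := A (k j.+1) `\` A (k j).
  have kmono i j : (i <= j)%N -> (k i <= k j)%N.
    move=> ij; rewrite -(subnKC ij); elim: (j - i)%N => [|p IH].
      by rewrite addn0.
    by rewrite addnS; apply: leq_trans IH _; exact: (mP _).1.
  apply: (@LUR_no_large_pieces f D c) => //.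
  - by move=> j; exact: measurableD.
  - apply/ltn_trivIset => i j ij; apply/eqP; apply/eqP.
    rewrite -subset0 => t [[Ai _] [_ Aj]]; apply: Aj.
    exact: ndA (kmono _ _ ij) _ Ai.
  - by move=> j; exact: (mP (k j)).2.
have gf : {ae mu, forall t, g t = f t}.
  have : {ae mu, forall t, forall n, cut (fun t => g t - f t) (A n) t = 0}.
    apply: ae_foralln => n; apply: kothe_ae0.
      exact: measurable_cut (kothe_measurable (fmemB Eg Ef)) _.
    move=> c c0; have [N NP] := kothe_cvg_lt c0 Ag.
    exists (fun t => cut f (A (maxn n N)) t - g t); split; first exact: fmemB.
      by apply: NP; exact: leq_maxr.
    apply: aeW => t; have [Ant|Ant] := pselect (A n t).
      rewrite !cut_in//; first by rewrite distrC.
      by apply: ndA Ant; exact: leq_maxl.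
    by rewrite (cut_out _ Ant) normr0.
  apply: filterS2 covA => t [n Ant] /(_ n).
  by rewrite cut_in// => /eqP; rewrite subr_eq0 => /eqP.
suff -> : (fun n => fnorm E (cut f (~` A n))) =
    (fun n => fnorm E (fun t => cut f (A n) t - g t)) by [].
apply/funext => n; rewrite -setTD -cutB; last exact: subsetT.
rewrite fnormBC//; last exact: fmem_cut.
apply: kothe_norm_ae_eq; [|exact: fmemB|].
  by apply: fmemB => //; exact: fmem_cut.
by apply: filterS gf => t gft; rewrite (@cut_in _ setT)// gft.
Qed.

End OrderContinuity.

(** * Transfer to the Bochner space *)

(** Converse of [sluacs_slope]: the slope estimate bounds [phi n x] from below
    whenever [phi n (u n)] is close to 1. *)
Lemma sluacs_of_slope (R : realType) (V : normedModType R) :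
  (forall (x : V) (u : nat -> V) (e : R), 0 < e < 1 -> `|x| = 1 ->
    (forall n, `|u n| = 1) -> `|u n + x| @[n --> \oo] --> (2 : R) ->
    exists2 t : R, 0 < t & forall N, exists2 n, (N <= n)%N &
      `|u n - t *: x| <= 1 - t * (1 - e)) ->
  sluacs V.
Proof.
move=> slope x u phi x1 u1 phi1 upx phiu.
apply/cvgrPdist_lt => e e0; apply: contrapT => noN.
have /choice[g gP] N : exists n, (N <= n)%N /\ phi n x <= 1 - e.
  apply: contrapT => non; apply: noN; exists N => // n /= Nn.
  have := dual_norm_le x (phi1 n); rewrite x1 => le1.
  rewrite ger0_norm ?subr_ge0// ltNge; apply/negP => h.
  by apply: non; exists n; split => //; lra.
have goo : g n @[n --> \oo] --> \oo by apply: cvg_natoo => n; case: (gP n).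
(* half of [e], kept below 1 *)
pose e' := Num.min e 1 / 2.
have e'P : [/\ 0 < e', e' < 1 & e' <= e / 2].
  have : 0 < Num.min e 1 by rewrite lt_min e0 ltr01.
  have : Num.min e 1 <= e by rewrite ge_min lexx.
  have : Num.min e 1 <= 1 by rewrite ge_min lexx orbT.
  by rewrite /e'; split; lra.
have [e'0 e'1 e'e] := e'P.
have [||||t t0 tP] := slope x (u \o g) e'.
- by rewrite e'0.
- by [].
- by move=> n; exact: u1.
- exact: cvg_comp goo upx.
(* with [phi n x <= 1 - e] the slope estimate keeps [phi n (u n)] at distance
   at least [t * (e / 2)] below 1 for infinitely many [n] *)
have te0 : 0 < t * (e / 2) by rewrite mulr_gt0// divr_gt0.
have [N _ NP] : \forall n \near \oo, 1 - t * (e / 2) < phi (g n) (u (g n)).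
  by apply: (cvgr_gt _ (cvg_comp _ _ goo phiu)); rewrite gtrBl.
have [n Nn nP] := tP N; have := NP n Nn.
have := dual_norm_le (u (g n) - t *: x) (phi1 (g n)).
rewrite linearB linearZ /= => h1; have := gP n => -[_].
rewrite -(ler_pM2l t0) => h2 h3.
have h4 : t * e' <= t * (e / 2) by rewrite ler_pM2l.
move: nP => /=; lra.
Qed.

Section KotheLattice.
Context d (T : measurableType d) (R : realType).
Context (mu : {measure set T -> \bar R}) (E : kothe_space mu).
Implicit Types (a p q w : T -> R) (b s : nat -> T -> R).

Lemma kothe_abs w : fmem E w ->
  fmem E (fun t => `|w t|) /\ fnorm E (fun t => `|w t|) = fnorm E w.
Proof.
move=> Ew; have mw := kothe_measurable Ew.
have maw : measurable_fun setT (fun t => `|w t|) by exact: measurableT_comp.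
have [Eaw le1] : fmem E (fun t => `|w t|) /\
    fnorm E (fun t => `|w t|) <= fnorm E w.
  by apply: kothe_le => // t; rewrite normr_id.
split => //; apply/eqP; rewrite eq_le le1 /=.
by apply: (kothe_le Eaw mw _).2 => t; rewrite normr_id.
Qed.

Lemma kothe_le_add w p q : fmem E p -> fmem E q -> measurable_fun setT w ->
  (forall t, `|w t| <= `|p t| + `|q t|) ->
  fnorm E w <= fnorm E p + fnorm E q.
Proof.
move=> Ep Eq mw wpq; have [Eap <-] := kothe_abs Ep; have [Eaq <-] := kothe_abs Eq.
apply: le_trans (fnormD Eap Eaq).
apply: (kothe_le (fmemD Eap Eaq) mw _).2 => t.
by apply: le_trans (wpq t) _; rewrite [leRHS]ger0_norm ?addr_ge0.
Qed.

(** Local uniform rotundity applies twice: to the norms [b n] themselves, and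
    to [min (s n / 2) a], which differs from [s n / 2] by at most [|b n - a|]. *)
Lemma LUR_norms_cvg a b s : LUR (fclass E) ->
  fmem E a -> (forall n, fmem E (b n)) -> (forall n, fmem E (s n)) ->
  (forall t, 0 <= a t) -> (forall n t, 0 <= b n t) ->
  (forall n t, 0 <= s n t <= b n t + a t) ->
  fnorm E (b n) @[n --> \oo] --> fnorm E a ->
  fnorm E (s n) @[n --> \oo] --> 2 * fnorm E a ->
  fnorm E (fun t => b n t - a t) @[n --> \oo] --> (0 : R) /\
  fnorm E (fun t => s n t - 2 * a t) @[n --> \oo] --> (0 : R).
Proof.
move=> lur Ea Eb Es a0 b0 sba bcvg scvg.
have ba : fnorm E (fun t => b n t - a t) @[n --> \oo] --> (0 : R).
  apply: LUR_fun => //.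
  apply: (@squeeze_cvgr _ _ _ _ (fun n => fnorm E (s n))
    (fun n => fnorm E (b n) + fnorm E a)) => //.
  - apply: nearW => n; apply/andP; split; last first.
      apply: kothe_le_add => //; last by move=> t; exact: ler_normD.
      exact: (kothe_measurable (fmemD (Eb n) Ea)).
    apply: (kothe_le (fmemD (Eb n) Ea) (kothe_measurable (Es n)) _).2 => t.
    have /andP[? ?] := sba n t.
    by rewrite !ger0_norm// addr_ge0.
  - have -> : 2 * fnorm E a = fnorm E a + fnorm E a by lra.
    by apply: cvgD => //; exact: cvg_cst.
split => //.
pose m n t := Num.min (2^-1 * s n t) (a t).
have mm n : measurable_fun setT (m n).
  apply: measurable_minr; last exact: (kothe_measurable Ea).
  exact: (kothe_measurable (fmemZ 2^-1 (Es n))).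
have m0a n t : 0 <= m n t <= a t.
  have /andP[s0 _] := sba n t.
  by rewrite /m le_min a0 mulr_ge0// ge_min lexx orbT.
have Em n : fmem E (m n).
  apply: (kothe_le Ea (mm n) _).1 => t; have /andP[? ?] := m0a n t.
  by rewrite !ger0_norm.
have sm n t : `|2^-1 * s n t - m n t| <= `|b n t - a t|.
  have /andP[_ sle] := sba n t; rewrite /m; case: (leP (2^-1 * s n t) (a t)) => h.
    by rewrite subrr normr0.
  by rewrite gtr0_norm ?subr_gt0//; apply: le_trans (ler_norm _); lra.
have ma : fnorm E (fun t => m n t - a t) @[n --> \oo] --> (0 : R).
  apply: LUR_dominated => //.
  apply: (@squeeze_cvgr _ _ _ _
    (fun n => 2^-1 * fnorm E (s n) - fnorm E (fun t => b n t - a t))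
    (fun=> fnorm E a)).
  - apply: nearW => n; apply/andP; split; last first.
      apply: (kothe_le Ea (mm n) _).2 => t; have /andP[? ?] := m0a n t.
      by rewrite !ger0_norm.
    rewrite lerBlDr.
    have -> : 2^-1 * fnorm E (s n) = fnorm E (fun t => 2^-1 *: s n t).
      by rewrite fnormZ// gtr0_norm// invr_gt0.
    apply: kothe_le_add => //; first exact: fmemB.
      exact: (kothe_measurable (fmemZ 2^-1 (Es n))).
    move=> t; have h := sm n t; rewrite -[leLHS]/(`|2^-1 * s n t|).
    rewrite -{1}(subrK (m n t) (2^-1 * s n t)).
    apply: le_trans (ler_normD _ _) _; rewrite addrC; exact: lerD.
  - have h : 2^-1 * fnorm E (s n) @[n --> \oo] --> 2^-1 * (2 * fnorm E a).
      by apply: cvgM => //; exact: cvg_cst.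
    have := cvgB h ba; rewrite mulrA mulVf ?mul1r ?subr0//; exact.
  - exact: cvg_cst.
apply: (@squeeze_cvgr _ _ _ _ (fun=> 0)
  (fun n => 2 * fnorm E (fun t => b n t - a t)
     + 2 * fnorm E (fun t => m n t - a t))).
- apply: nearW => n.
  have Es2 : fmem E (fun t => s n t - 2 * a t).
    exact: (fmemB (Es n) (fmemZ 2 Ea)).
  rewrite fnorm_ge0//=.
  have n2 w : fmem E w -> 2 * fnorm E w = fnorm E (fun t => 2 *: w t).
    by move=> Ew; rewrite fnormZ// gtr0_norm.
  rewrite !n2; [|exact: fmemB..].
  apply: kothe_le_add; [exact/fmemZ/fmemB..|exact: (kothe_measurable Es2)|].
  move=> t; rewrite !normrZ gtr0_norm//; have := sm n t => h.
  have -> : s n t - 2 * a t = 2 * (2^-1 * s n t - m n t) + 2 * (m n t - a t).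
    by lra.
  apply: le_trans (ler_normD _ _) _; rewrite !normrM gtr0_norm// lerD2r.
  by rewrite ler_pM2l.
- exact: cvg_cst.
- have := cvgD (cvgM (@cvg_cst _ (2 : R) _ _ _) ba)
    (cvgM (@cvg_cst _ (2 : R) _ _ _) ma).
  by rewrite mulr0 addr0; exact.
Qed.

End KotheLattice.

Section KotheBochnerSlope.
Context d (T : measurableType d) (R : realType).
Context (mu : {measure set T -> \bar R}) (cmu : measure_is_complete mu).
Context (E : kothe_space mu) (X : normedModType R).
Let K := kothe_bochner cmu E X.

(** [sluacs_slope] holds at almost every point with a step depending on the
    point; the set [A m] collects the points where the step [m.+1^-1] works from
    index [m] on, and order continuity of [E] discards the rest. *)
Lemma kothe_bochner_slope (f : T -> X) (h : nat -> T -> X) (e : R) :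
  LUR (fclass E) -> sluacs X -> 0 < e < 1 ->
  fmem K f -> (forall n, fmem K (h n)) ->
  fnorm K f = 1 -> (forall n, fnorm K (h n) = 1) ->
  fnorm K (fun t => h n t + f t) @[n --> \oo] --> (2 : R) ->
  exists2 t : R, 0 < t & forall N, exists2 n, (N <= n)%N &
    fnorm K (fun s => h n s - t *: f s) <= 1 - t * (1 - e).
Proof.
move=> lur acs /andP[e0 e1] Kf Kh f1 h1 hpf.
have KE g : fmem K g -> fmem E (fun t => `|g t|) by case.
pose a t := `|f t|; pose b n t := `|h n t|; pose s n t := `|h n t + f t|.
have a0 t : 0 <= a t by exact: normr_ge0.
have b0 n t : 0 <= b n t by exact: normr_ge0.
have Ea : fmem E a by exact: KE.
have Eb n : fmem E (b n) by exact: KE.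
have Es n : fmem E (s n) by exact: KE (fmemD (Kh n) Kf).
have [ba sa] : fnorm E (fun t => b n t - a t) @[n --> \oo] --> (0 : R) /\
    fnorm E (fun t => s n t - 2 * a t) @[n --> \oo] --> (0 : R).
  apply: LUR_norms_cvg => //.
  - by move=> n t; rewrite normr_ge0 /= ler_normD.
  - rewrite (_ : (fun n => _) = fun=> fnorm E a); first exact: cvg_cst.
    by apply/funext => n; rewrite -[LHS]/(fnorm K (h n)) h1 -f1.
  - by rewrite -[fnorm E a]/(fnorm K f) f1 mulr1.
pose k n t := `|b n t - a t| + `|s n t - 2 * a t|.
have Eba n : fmem E (fun t => b n t - a t) by exact: fmemB.
have Esa n : fmem E (fun t => s n t - 2 * a t).
  exact: (fmemB (Es n) (fmemZ 2 Ea)).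
have Ek n : fmem E (k n).
  exact: fmemD (kothe_abs (Eba n)).1 (kothe_abs (Esa n)).1.
have k0 n t : 0 <= k n t by rewrite addr_ge0.
have [g gn gk] : exists2 g : nat -> nat, forall n, (n <= g n)%N &
    {ae mu, forall t, k (g n) t @[n --> \oo] --> (0 : R)}.
  apply: (kothe_cvg0_ae_subseq Ek k0).
  apply: (@squeeze_cvgr _ _ _ _ (fun=> 0) (fun n =>
    fnorm E (fun t => b n t - a t) + fnorm E (fun t => s n t - 2 * a t))).
  - apply: nearW => n; rewrite fnorm_ge0//=.
    apply: kothe_le_add => //; first exact: (kothe_measurable (Ek n)).
    by move=> t; rewrite ger0_norm.
  - exact: cvg_cst.
  - by rewrite -[X in _ --> X](addr0 (0 : R)); exact: cvgD.
have goo : g n @[n --> \oo] --> \oo by exact: cvg_natoo.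
(* the error [e] is spent as follows: [e'] on the slope at the points of [A m],
   [e'] on [b n - a], and [2 * e'] on the complement of [A m] *)
pose e' := e / 4.
have e'0 : 0 < e' by rewrite /e'; lra.
pose tau n : R := n.+1%:R^-1.
have tau_gt0 n : 0 < tau n by rewrite invr_gt0 ltr0n.
pose good m n := [set t | `|h (g n) t - tau m *: f t|
  <= `|h (g n) t| - tau m * ((1 - e') * `|f t|)].
pose A m := \bigcap_(n in [set n | (m <= n)%N]) good m n.
have mA m : measurable (A m).
  apply: bigcap_measurable; first by exists m => /=.
  move=> n _; rewrite -(setTI (good m n)).
  apply: measurable_fun_le => //.
    exact: (kothe_measurable (KE _ (fmemB (Kh (g n)) (fmemZ (tau m) Kf)))).
  apply: measurable_funB; first exact: (kothe_measurable (Eb _)).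
  apply: measurable_funM => //; apply: measurable_funM => //.
  exact: (kothe_measurable Ea).
have ndA : {homo A : m n / (m <= n)%N >-> m `<=` n}.
  move=> m n mn t At l /= nl; have := At l (leq_trans mn nl).
  apply: slope_le => //; first exact: ltW.
  by rewrite lef_pV2 ?posrE ?ltr0n// ler_nat ltnS.
have covA : {ae mu, forall t, exists m, A m t}.
  apply: filterS gk => t kt.
  have bat : `|h (g n) t| @[n --> \oo] --> `|f t|.
    apply/cvgrPdist_lt => c c0.
    apply: filterS (cvgr_lt _ kt _ c0) => n; apply: le_lt_trans.
    by rewrite distrC /k lerDl.
  have sat : `|h (g n) t + f t| @[n --> \oo] --> 2 * `|f t|.
    apply/cvgrPdist_lt => c c0.
    apply: filterS (cvgr_lt _ kt _ c0) => n; apply: le_lt_trans.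
    by rewrite distrC /k lerDr.
  by have [m mP] := sluacs_slope acs e'0 bat sat; exists m.
have [m cutm] : exists m, fnorm E (cut a (~` A m)) < e'.
  have := LUR_order_continuous lur Ea a0 mA ndA covA.
  by move=> /cvgr_lt/(_ _ e'0)[M _ MP]; exists M; exact: MP (leqnn M).
set C := cut a (~` A m) in cutm.
have EC : fmem E C by apply: fmem_cut => //; exact: measurableC.
exists (tau m) => // N.
have [N1 _ N1P] := cvgr_lt _ (cvg_comp _ _ goo ba) _ e'0.
pose n := maxn m (maxn N N1).
have mn : (m <= n)%N by exact: leq_maxl.
have Nn : (N <= n)%N by rewrite /n !leq_max leqnn ?orbT.
have N1n : (N1 <= n)%N by rewrite /n !leq_max leqnn ?orbT.
exists (g n); first exact: leq_trans Nn (gn n).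
have ban : fnorm E (fun t => b (g n) t - a t) < e' by exact: N1P.
have tau_le1 : tau m <= 1 by rewrite invf_le1 ?ltr0n// ler1n.
have tg0 := tau_gt0 m; set t := tau m in tg0 tau_le1 *.
pose c := t * (1 - e').
have c0 : 0 <= c by rewrite mulr_ge0 ?ltW// /e'; lra.
have ct : c <= t by rewrite /c ger_pMr// /e'; lra.
have bound : fnorm K (fun s => h (g n) s - t *: f s) <=
    fnorm E (fun s => (1 - c) *: b (g n) s) +
    fnorm E (fun s => c *: (b (g n) s - a s) + (2 * t) *: C s).
  apply: kothe_le_add.
  - exact: fmemZ.
  - by apply: fmemD; apply: fmemZ.
  - exact: (kothe_measurable (KE _ (fmemB (Kh (g n)) (fmemZ t Kf)))).
  - move=> r; rewrite ger0_norm//.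
    apply: (@le_trans _ _ ((1 - c) * b (g n) r + (c * (b (g n) r - a r)
        + 2 * t * C r))); last by apply: lerD; exact: ler_norm.
    have [Ar|Ar] := pselect (A m r).
      have := Ar n mn; rewrite /good /= mulrA -/t -/c /C cut_out; last by apply.
      by rewrite -/(a r) -/(b (g n) r); lra.
    rewrite /C cut_in//.
    have : `|h (g n) r - t *: f r| <= b (g n) r + t * a r.
      by apply: le_trans (ler_normB _ _) _; rewrite normrZ gtr0_norm.
    have : c * a r <= t * a r by rewrite ler_wpM2r.
    lra.
apply: le_trans bound _; rewrite fnormZ// -[fnorm E (b _)]/(fnorm K (h (g n))) h1.
rewrite mulr1 ger0_norm; last by lra.
have : fnorm E (fun s => c *: (b (g n) s - a s) + (2 * t) *: C s)
    <= c * fnorm E (fun t => b (g n) t - a t) + 2 * t * fnorm E C.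
  apply: le_trans (fnormD (fmemZ c (Eba (g n))) (fmemZ (2 * t) EC)) _.
  by rewrite !fnormZ// !ger0_norm// mulr_ge0// ltW.
have : c * fnorm E (fun t => b (g n) t - a t) <= t * e'.
  by rewrite ler_pM ?fnorm_ge0// ltW.
have : t * fnorm E C <= t * e' by rewrite ler_pM2l// ltW.
by rewrite /c /e'; lra.
Qed.

End KotheBochnerSlope.

Theorem theorem3p7 (d : measure_display) (T : measurableType d) (R : realType)
    (mu : {measure set T -> \bar R})
    (mu_complete : measure_is_complete mu)
    (mu_sigma_finite : sigma_finite setT mu)
    (E : kothe_space mu) (X : completeNormedModType R) :
  LUR (fclass E) -> sluacs X -> sluacs (fclass (kothe_bochner mu_complete E X)).
Proof.
move=> lur acs; apply: sluacs_of_slope => x u e e01 x1 u1 upx.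
have [f [Ff xE]] := class_of_surj x.
have /choice[h hP] n := class_of_surj (u n).
pose Fh n := projT1 (cid (hP n)).
have uE n : u n = class_of (Fh n) by exact: projT2 (cid (hP n)).
have f1 : fnorm (kothe_bochner mu_complete E X) f = 1.
  by rewrite -(norm_class_of Ff) -xE.
have h1 n : fnorm (kothe_bochner mu_complete E X) (h n) = 1.
  by rewrite -(norm_class_of (Fh n)) -uE.
have hpf : fnorm (kothe_bochner mu_complete E X) (fun t => h n t + f t)
    @[n --> \oo] --> (2 : R).
  by under eq_fun do rewrite -(norm_class_ofD (Fh _) Ff) -uE -xE.
have [t t0 tP] := kothe_bochner_slope lur acs e01 Ff Fh f1 h1 hpf.
exists t => // N; have [n Nn nP] := tP N; exists n => //.
by rewrite xE uE class_ofZ norm_class_ofB.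
Qed.
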